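(* Let $q\in\mathbb{K}\setminus\{0\}$. The $q$-deformed $W(2,2)$ Hom-Lie algebra $(\mathcal{W}^{q},[\cdot,\cdot],\alpha)$ is multiplicative if and only if $q^2=-1$ (which is equivalent to $q=\pm i$ if there exists $i\in\mathbb{K}$ such that $i^2=-1$).
   Context: $\mathbb{K}$ is a field of characteristic zero and $q\in\mathbb{K}\setminus\{0\}$. For $n\in\mathbb{Z}$ put $[n]=\frac{q^n-q^{-n}}{q-q^{-1}}$ if $q\neq\pm1$, $[n]=n$ if $q=1$, and $[n]=(-1)^{n-1}n$ if $q=-1$. The $q$-deformed $W(2,2)$ Hom-Lie algebra $(\mathcal{W}^q,[\cdot,\cdot],\alpha)$ is the $\mathbb{K}$-vector space with basis $\{L_n,W_n\mid n\in\mathbb{Z}\}$, with the skew-symmetric bilinear product determined by $[L_m,L_n]=[m-n]L_{m+n}$, $[L_m,W_n]=[m-n]W_{m+n}$, $[W_m,W_n]=0$, and with the linear map $\alpha(L_n)=(q^n+q^{-n})L_n$, $\alpha(W_n)=(q^n+q^{-n})W_n$. A Hom-algebra $(A,[\cdot,\cdot],\alpha)$ is multiplicative if $\alpha([x,y])=[\alpha(x),\alpha(y)]$ for all $x,y\in A$. *)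

(* Defs.v *)
(* {freeg T / K} is the free K-module on T (finitely supported formal sums);
   <<a>> is the basis vector attached to a : T, and fglift f is the linear map
   sending each <<a>> to f a. *)
From HB Require Import structures.
From mathcomp Require Import all_boot all_order all_algebra.
From mathcomp Require Import freeg.

Set Implicit Arguments.
Unset Strict Implicit.
Unset Printing Implicit Defensive.

Import GRing.Theory.
Local Open Scope ring_scope.

Record homAlgebra (K : fieldType) := HomAlgebra {
  ha_carrier :> lmodType K;
  ha_bracket : {bilinear ha_carrier -> ha_carrier -> ha_carrier};
  ha_twist : {linear ha_carrier -> ha_carrier}
}.

Definition multiplicative_ha (K : fieldType) (A : homAlgebra K) : Prop :=
  forall x y : A,
    ha_twist A (ha_bracket A x y) = ha_bracket A (ha_twist A x) (ha_twist A y).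

Section LinearExtension.
Variables (K : fieldType) (T : choiceType).

Lemma fglift_is_linear (M : lmodType K) (f : T -> M) :
  linear (fglift f : {freeg T / K} -> M).
Proof.
pose fB : {freeg T / K} -> M := fglift f.
pose fA := GRing.isZmodMorphism.Build _ _ fB (lift_is_additive f).
pose g : {additive {freeg T / K} -> M} := HB.pack fB fA.
have gE D : g D = \sum_(x <- dom D) coeff x D *: f x.
  rewrite -{1}[D]freeg_sumE raddf_sum.
  by apply: eq_bigr => x _; exact: liftU.
move=> c D E; rewrite -[LHS]/(g (c *: D + E)) raddfD; congr (_ + _).
rewrite -[RHS]/(c *: g D) (gE D) scaler_sumr.
rewrite [X in g X = _](_ : _ = \sum_(x <- dom D) << c * coeff x D *g x >>) //.
rewrite raddf_sum; apply: eq_bigr => x _; rewrite scalerA; exact: liftU.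
Qed.

Lemma fglift_ext (M : lmodType K) (f g : T -> M) (D : {freeg T / K}) :
  f =1 g -> fglift f D = fglift g D.
Proof.
move=> fg; rewrite -[D]Freeg_enum !fglift_Freeg /prelift.
by apply: eq_bigr => x _; rewrite fg.
Qed.

Lemma fglift_comb (M : lmodType K) (f g : T -> M) (c : K)
    (D : {freeg T / K}) :
  fglift (fun x => c *: f x + g x) D = c *: fglift f D + fglift g D.
Proof.
rewrite -[D]Freeg_enum !fglift_Freeg /prelift scaler_sumr -big_split /=.
by apply: eq_bigr => x _; rewrite scalerDr !scalerA mulrC.
Qed.

Definition bilin_ext (M : lmodType K) (f : T -> T -> M)
    (x y : {freeg T / K}) : M :=
  fglift (fun a => fglift (f a) y) x.

Lemma bilin_ext_is_bilinear (M : lmodType K) (f : T -> T -> M) :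
  bilinear_for (GRing.Scale.Law.clone _ _ *:%R _)
    (GRing.Scale.Law.clone _ _ *:%R _) (bilin_ext f).
Proof.
split=> [y | x] c u v; first exact: fglift_is_linear.
rewrite /bilin_ext /= -fglift_comb; apply: fglift_ext => a.
exact: fglift_is_linear.
Qed.

Lemma bilin_extU (M : lmodType K) (f : T -> T -> M) (a b : T) :
  bilin_ext f << a >> << b >> = f a b.
Proof. by rewrite /bilin_ext !liftU !scale1r. Qed.

End LinearExtension.

Section W22.
Variables (K : fieldType) (q : K).

(* The q-number [n]; q^n is the integer power, with q^(-n) = (q^n)^-1. *)
Definition qint (n : int) : K :=
  if q == 1 then n%:~R
  else if q == -1 then (-1) ^ (n - 1) * n%:~R
  else (q ^ n - q ^ (- n)) / (q - q^-1).

(* The basis vectors L_n and W_n are indexed by inl n and inr n respectively. *)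
Definition W22 := {freeg (int + int)%type / K}.

HB.instance Definition _ := GRing.Lmodule.on W22.

Definition LL (n : int) : W22 := << inl n >>.
Definition WW (n : int) : W22 := << inr n >>.

(* Bracket of two basis vectors; the third clause is forced by skew-symmetry,
   [W_m, L_n] = - [L_n, W_m]. *)
Definition W22_brb (a b : int + int) : W22 :=
  match a, b with
  | inl m, inl n => qint (m - n) *: LL (m + n)
  | inl m, inr n => qint (m - n) *: WW (m + n)
  | inr m, inl n => - (qint (n - m) *: WW (n + m))
  | inr _, inr _ => 0
  end.

Definition W22_twb (a : int + int) : W22 :=
  match a with
  | inl n => (q ^ n + q ^ (- n)) *: LL n
  | inr n => (q ^ n + q ^ (- n)) *: WW n
  end.

Definition W22_bracket : W22 -> W22 -> W22 := bilin_ext W22_brb.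
Definition W22_twist : W22 -> W22 := fglift W22_twb.

HB.instance Definition _ := bilinear_isBilinear.Build K W22 W22 W22 _ _
  W22_bracket (bilin_ext_is_bilinear W22_brb).
HB.instance Definition _ := GRing.isLinear.Build K W22 W22 _
  W22_twist (fglift_is_linear W22_twb).

Definition qW22 : homAlgebra K := @HomAlgebra K W22 W22_bracket W22_twist.

Lemma qintN n : qint (- n) = - qint n.
Proof.
rewrite /qint; case: ifP => _; first by rewrite mulrNz.
case: ifP => _; last by rewrite opprK -mulNr opprB.
have N1 : (-1 : K) != 0 by rewrite oppr_eq0 oner_eq0.
have N1V : (-1 : K)^-1 = -1 by rewrite invrN invr1.
by rewrite mulrNz mulrN !expfzDr // -[in LHS]exprz_inv N1V.
Qed.

Lemma W22_bracketLL m n :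
  W22_bracket (LL m) (LL n) = qint (m - n) *: LL (m + n).
Proof. exact: bilin_extU. Qed.

Lemma W22_bracketLW m n :
  W22_bracket (LL m) (WW n) = qint (m - n) *: WW (m + n).
Proof. exact: bilin_extU. Qed.

Lemma W22_bracketWW m n : W22_bracket (WW m) (WW n) = 0.
Proof. exact: bilin_extU. Qed.

Lemma W22_twistL n : W22_twist (LL n) = (q ^ n + q ^ (- n)) *: LL n.
Proof. by rewrite /W22_twist /LL liftU scale1r. Qed.

Lemma W22_twistW n : W22_twist (WW n) = (q ^ n + q ^ (- n)) *: WW n.
Proof. by rewrite /W22_twist /WW liftU scale1r. Qed.

Lemma W22_brbC a b : W22_brb a b = - W22_brb b a.
Proof.
case: a b => [m|m] [n|n] /=; rewrite ?opprK ?oppr0 //.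
by rewrite -scaleNr -qintN opprB [n + m]addrC.
Qed.

Lemma W22_bracketC x y : W22_bracket x y = - W22_bracket y x.
Proof.
rewrite /W22_bracket /bilin_ext -[x]Freeg_enum -[y]Freeg_enum.
rewrite !fglift_Freeg /prelift -sumrN.
under eq_bigr do rewrite fglift_Freeg /prelift scaler_sumr.
under [RHS]eq_bigr do rewrite fglift_Freeg /prelift scaler_sumr -sumrN.
rewrite exchange_big; apply: eq_bigr => b _; apply: eq_bigr => a _.
by rewrite W22_brbC !scalerN !scalerA mulrC.
Qed.

End W22.

(* Main.v *)
Require Import Defs.
From mathcomp Require Import all_boot all_order all_algebra.
From mathcomp Require Import freeg ring.

Set Implicit Arguments.
Unset Strict Implicit.
Unset Printing Implicit Defensive.

Import GRing.Theory.
Local Open Scope ring_scope.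

(** Write [t n = q ^ n + q ^ (- n)] for the eigenvalue of the twist on the
    basis vectors of degree [n].  On basis vectors of degrees [m] and [n],
    multiplicativity compares [qint (m - n) * t (m + n)] with
    [t m * t n * qint (m - n)].  The product formula
    [t m * t n = t (m + n) + t (m - n)] ([twist_eigenM]), familiar from
    cosines, shows that the two agree exactly when [qint k * t k = 0] for
    [k = m - n].

    For [k = 1] this reads [q + q^-1 = 0], that is [q ^+ 2 = -1].  Conversely,
    away from [q = 1] and [q = -1], [qint k * t k] is a multiple of
    [q ^ (2 k) - q ^ (- 2 k)]; when [q ^+ 2 = -1] this vanishes because
    [(-1) ^ k] is its own inverse ([qint_twist_eigen]).  Both sides of the
    multiplicativity identity are bilinear, so it is enough to check it on
    basis vectors ([freeg_linear_ext]). *)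

Section LinearMapsOnFreeModule.
Variables (K : fieldType) (T : choiceType) (M : lmodType K).

Lemma freegUZ (c : K) (a : T) : << c *g a >> = c *: << a >> :> {freeg T / K}.
Proof. by apply/eqP/freeg_eqP => b; rewrite coeffZ !coeffU mul1r. Qed.

Lemma linear_freegU (f : {linear {freeg T / K} -> M}) (c : K) (a : T) :
  f << c *g a >> = c *: f << a >>.
Proof. by rewrite freegUZ; exact: linearZ. Qed.

Lemma freeg_linear_ext (f g : {linear {freeg T / K} -> M}) :
  (forall a, f << a >> = g << a >>) -> f =1 g.
Proof.
move=> fg x; rewrite -[x]freeg_sumE !raddf_sum; apply: eq_bigr => a _.
apply: (etrans (linear_freegU f _ _)); rewrite fg.
exact/esym/linear_freegU.
Qed.

End LinearMapsOnFreeModule.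

Section TwistEigenvalues.
Variables (K : fieldType) (q : K).
Hypothesis q_neq0 : q != 0.

Definition twist_eigen (n : int) : K := q ^ n + q ^ (- n).

Lemma twist_eigenM m n :
  twist_eigen m * twist_eigen n = twist_eigen (m + n) + twist_eigen (m - n).
Proof.
rewrite /twist_eigen !opprD opprK !expfzDr //; ring.
Qed.

Lemma qint1 : qint q 1 = 1.
Proof.
rewrite /qint; case: eqVneq => // q_neq1; case: eqVneq => [_|q_neqN1].
  by rewrite subrr expr0z mul1r.
rewrite expr1z divff // subr_eq0; apply/eqP => qV.
have : q ^+ 2 == 1 by rewrite expr2 {2}qV divff.
by rewrite sqrf_eq1 (negPf q_neq1) (negPf q_neqN1).
Qed.

Lemma twist_eigen1_eq0 : (twist_eigen 1 == 0) = (q ^+ 2 == -1).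
Proof.
rewrite /twist_eigen expr1z -(inj_eq (mulfI q_neq0)) mulr0 mulrDr divff //.
by rewrite addr_eq0 expr2.
Qed.

(** If [q] is [1] or [-1], the hypothesis forces [1 = -1] in [K]; then [q = 1]
    and the eigenvalue [1 + 1] vanishes.  Otherwise the product is a difference
    of squares. *)
Lemma qint_twist_eigen k : q ^+ 2 = -1 -> qint q k * twist_eigen k = 0.
Proof.
move=> q2; rewrite /qint; case: eqVneq => [q1|q_neq1].
  move: q2; rewrite /twist_eigen q1 expr1n !exp1rz => N1.
  by rewrite [X in _ * (_ + X)]N1 subrr mulr0.
case: eqVneq => [qN1|_].
  by move: q_neq1; rewrite qN1 -q2 qN1 sqrrN expr1n eqxx.
rewrite mulrAC /twist_eigen -subr_sqr.
have sq n : (q ^ n) ^+ 2 = (-1) ^ n.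
  by rewrite exprnP exprz_exp mulrC -exprz_exp -exprnP q2.
by rewrite !sq -[in X in _ - X]exprz_inv invrN invr1 subrr mul0r.
Qed.

End TwistEigenvalues.

Section Multiplicativity.
Variables (K : fieldType) (q : K).
Hypothesis q_neq0 : q != 0.

Lemma qint_twist_eigenM m n : q ^+ 2 = -1 ->
  qint q (m - n) * twist_eigen q (m + n)
  = twist_eigen q m * twist_eigen q n * qint q (m - n).
Proof.
move=> q2; rewrite [RHS]mulrC twist_eigenM // [RHS]mulrDr.
by rewrite (qint_twist_eigen (m - n) q2) addr0.
Qed.

Lemma W22_bracket_twistU (a b : int + int) : q ^+ 2 = -1 ->
  W22_twist q (W22_bracket q << a >> << b >>)
  = W22_bracket q (W22_twist q << a >>) (W22_twist q << b >>).
Proof.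
move=> q2.
have twL n : W22_twist q (LL K n) = twist_eigen q n *: LL K n.
  exact: W22_twistL.
have twW n : W22_twist q (WW K n) = twist_eigen q n *: WW K n.
  exact: W22_twistW.
have LW m n : W22_twist q (W22_bracket q (LL K m) (WW K n))
    = W22_bracket q (W22_twist q (LL K m)) (W22_twist q (WW K n)).
  rewrite twL twW linearZlr /= !W22_bracketLW linearZZ /= twW !scalerA.
  by rewrite qint_twist_eigenM.
have LLm m n : W22_twist q (W22_bracket q (LL K m) (LL K n))
    = W22_bracket q (W22_twist q (LL K m)) (W22_twist q (LL K n)).
  rewrite !twL linearZlr /= !W22_bracketLL linearZZ /= twL !scalerA.
  by rewrite qint_twist_eigenM.
have WWm m n : W22_twist q (W22_bracket q (WW K m) (WW K n))
    = W22_bracket q (W22_twist q (WW K m)) (W22_twist q (WW K n)).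
  by rewrite !twW linearZlr /= !W22_bracketWW linear0 !scaler0.
case: a b => m [] n; [exact: LLm | exact: LW | | exact: WWm].
rewrite W22_bracketC [RHS]W22_bracketC linearN; congr (- _); exact: LW.
Qed.

Lemma W22_multiplicative : q ^+ 2 = -1 -> multiplicative_ha (qW22 q).
Proof.
move=> q2 x y.
pose tw : {linear W22 K -> W22 K} := @W22_twist K q.
pose br : {bilinear W22 K -> W22 K -> W22 K} := @W22_bracket K q.
(* For fixed x both sides are linear in y; for a basis vector y, in x. *)
rewrite -[LHS]/((tw \o br x) y) -[RHS]/((br (tw x) \o tw) y).
apply: freeg_linear_ext => b /=.
rewrite -[LHS]/((tw \o applyr br << b >>) x).
rewrite -[RHS]/((applyr br (tw << b >>) \o tw) x).
apply: freeg_linear_ext => a; exact: W22_bracket_twistU.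
Qed.

Lemma LL_scaleI (n : int) : injective (fun c : K => c *: LL K n).
Proof.
move=> c d /(congr1 (coeff (inl n))); rewrite !coeffZ !coeffU.
by rewrite eqxx !mulr1.
Qed.

(** The basis vectors [L_1] and [L_0] have [qint 1 = 1] and [t 0 = 2], so
    multiplicativity on them reads [t 1 = 2 t 1], which forces [t 1 = 0]. *)
Lemma W22_multiplicative_sqr : multiplicative_ha (qW22 q) -> q ^+ 2 = -1.
Proof.
move=> /(_ (LL K 1) (LL K 0)) /=.
rewrite !W22_twistL -!/(twist_eigen q _) linearZlr /= !W22_bracketLL.
rewrite linearZZ /= W22_twistL -/(twist_eigen q _) !scalerA.
move=> /LL_scaleI; rewrite subr0 qint1 // mulr1 mul1r.
rewrite twist_eigenM // subr0.
move=> t1E; apply/eqP; rewrite -twist_eigen1_eq0 //; apply/eqP.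
by apply: (addrI (twist_eigen q 1)); rewrite -t1E addr0.
Qed.

End Multiplicativity.

Theorem proposition2p12 (K : fieldType) (charK : [pchar K] =i pred0)
    (q : K) (q_neq0 : q != 0) :
  (multiplicative_ha (qW22 q) <-> q ^+ 2 = -1) /\
  (forall i : K, i ^+ 2 = -1 -> (q ^+ 2 = -1 <-> q = i \/ q = - i)).
Proof.
split.
  by split; [exact: W22_multiplicative_sqr | exact: W22_multiplicative].
move=> i <-; split=> [/eqP | [] ->]; rewrite ?sqrrN //.
by rewrite eqf_sqr => /orP[] /eqP; [left | right].
Qed.
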